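(* Let $\sigma$ be a term ordering on the power products of $\mathbb{R}[x_1,\dots,x_s]$, let $\epsilon>0$, and let $\overline{\mathcal P}=(\overline p_1,\dots,\overline p_m)$ be a tuple of $m\ge 1$ points of $\mathbb{R}^s$ (the preprocessed data points). Let $\overline{\mathcal N}$ and $\overline{GB}$ be the output of the ABM algorithm (described in the context) on input $(\sigma,\overline{\mathcal P},\epsilon)$, and assume that $\overline{\mathcal N}=\{\overline t_1,\dots,\overline t_m\}$ has exactly $m$ elements, numbered so that $\overline t_1<_\sigma\dots<_\sigma\overline t_m$. Let $\overline M_m(\overline{\mathcal P})=[\overline t_1(\overline{\mathcal P}),\dots,\overline t_m(\overline{\mathcal P})]$ (an invertible $m\times m$ matrix), with 2-norm condition number $K_2(\overline M_m(\overline{\mathcal P}))$, the ratio of its largest singular value to its smallest. Let $\overline g=\overline t-\sum_{i=1}^k\overline c_i\,\overline t_i\in\overline{GB}$ be a polynomial computed by the algorithm, with leading term $\overline t$ satisfying $\overline t(\overline{\mathcal P})\ne 0$ and coefficient vector $\overline c\in\mathbb{R}^k$, and let $g_E=\overline t-\sum_{j=1}^m c^E_j\,\overline t_j$ be the corresponding polynomial of the extended basis, whose coefficient vector $c_E=(c^E_1,\dots,c^E_m)^T$ is the solution of $\overline M_m(\overline{\mathcal P})\,c_E=\overline t(\overline{\mathcal P})$. Put $$\Delta c=c_E-\begin{bmatrix}\overline c\\ 0\end{bmatrix}\in\mathbb{R}^m .$$ Then $$\frac{\|\Delta c\|_2}{\|c_E\|_2}\ \le\ \frac{\|\overline g(\overline{\mathcal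 P})\|_2}{\|\overline t(\overline{\mathcal P})\|_2}\,K_2(\overline M_m(\overline{\mathcal P}))\ \le\ \epsilon\,K_2(\overline M_m(\overline{\mathcal P})).$$
   Context: For a polynomial $g$ and a tuple of points $\mathcal P=(p_1,\dots,p_m)$, $g(\mathcal P)=(g(p_1),\dots,g(p_m))^T\in\mathbb{R}^m$. A term (power product) is a monomial $x_1^{j_1}\cdots x_s^{j_s}$ with coefficient 1. ABM algorithm. Input: a term ordering $\sigma$, points $\overline{\mathcal P}=(\overline p_1,\dots,\overline p_m)$, a threshold $\epsilon>0$. Output: a set of polynomials $\overline{GB}$ and a set of power products $\overline{\mathcal N}$. Both sets start empty. Terms are selected as in the Buchberger-Möller algorithm: start with the list $L=\{1\}$; at each step, remove from $L$ its $\sigma$-smallest element $\overline t$ and process it as follows; stop when $L$ is empty. Let $\overline t_1,\dots,\overline t_k$ be the terms currently in $\overline{\mathcal N}$ (all are $<_\sigma\overline t$; they are the first $k$ elements, in $\sigma$-increasing order, of the final set $\overline{\mathcal N}$) and let $\overline M_k(\overline{\mathcal P})=[\overline t_1(\overline{\mathcal P}),\dots,\overline t_k(\overline{\mathcal P})]$. Let $\overline c\in\mathbb{R}^k$ be the least squares solution of $\overline M_k(\overline{\mathcal P})\,\overline c=\overline t(\overline{\mathcal P})$ and let $\overline r=\overline t(\overline{\mathcal P})-\overline M_k(\overline{\mathcal P})\,\overline c$ be its residual (for $k=0$, $\overline r=\overline t(\overline{\mathcal P})$). If $\|\overline r\|_2>\epsilon\,\|\overline t(\overline{\mathcal P})\|_2$,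 put $\overline t$ into $\overline{\mathcal N}$ and add to $L$ those of $x_1\overline t,\dots,x_s\overline t$ that are not multiples of a leading term of an element of $\overline{GB}$. Otherwise, put the polynomial $\overline g=\overline t-\sum_{i=1}^k\overline c_i\,\overline t_i$ (with leading term $\overline t$) into $\overline{GB}$ and remove from $L$ all multiples of $\overline t$. All computations are in exact arithmetic. *)

(* Defs.v *)
From HB Require Import structures.
From mathcomp Require Import all_boot all_order all_algebra.
From mathcomp Require Import finmap mpoly polyrcf reals.

Set Implicit Arguments.
Unset Strict Implicit.
Unset Printing Implicit Defensive.

Import Order.TTheory GRing.Theory Num.Theory.

Local Open Scope fset_scope.
Local Open Scope ring_scope.

(* Terms x_1^j_1 ... x_s^j_s are represented by their exponent vectors
   ['X_{1..s}]: the term 1 is [0%MM], the product of terms is [(t + u)%MM],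
   x_i is [U_(i)%MM], and "u is a multiple of t" is [(t <= u)%MM]. *)
Record term_ordering (s : nat) (sigma : rel 'X_{1..s}) : Prop := TermOrdering {
  term_ordering_refl : reflexive sigma;
  term_ordering_anti : antisymmetric sigma;
  term_ordering_trans : transitive sigma;
  term_ordering_total : total sigma;
  term_ordering_ge1 : forall t, sigma 0%MM t;
  term_ordering_mul : forall t u v, sigma t u -> sigma (t + v)%MM (u + v)%MM
}.

Definition term_lt (s : nat) (sigma : rel 'X_{1..s}) : rel 'X_{1..s} :=
  fun t u => (t != u) && sigma t u.

Definition is_leading_term (R : realType) (s : nat) (sigma : rel 'X_{1..s})
    (g : {mpoly R[s]}) (t : 'X_{1..s}) : bool :=
  (t \in msupp g) && all (fun u => sigma u t) (msupp g).

Definition increasing_enum (s : nat) (sigma : rel 'X_{1..s})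
    (N : {fset 'X_{1..s}}) (k : nat) (ts : k.-tuple 'X_{1..s}) : Prop :=
  sorted (term_lt sigma) ts /\ N =i ts.

Definition norm2 (R : realType) (n : nat) (v : 'cV[R]_n) : R :=
  Num.sqrt (\sum_(i < n) v i 0 ^+ 2).

Definition is_lsq_solution (R : realType) (m k : nat)
    (A : 'M[R]_(m, k)) (b : 'cV[R]_m) (c : 'cV[R]_k) : Prop :=
  forall c' : 'cV[R]_k, norm2 (b - A *m c) <= norm2 (b - A *m c').

(* The distinct singular values of a square matrix: [rootsR] lists all the
   roots in R, so here all the eigenvalues of A^T A. *)
Definition singular_values (R : realType) (n : nat) (A : 'M[R]_n) : seq R :=
  [seq Num.sqrt a | a <- rootsR (char_poly (A^T *m A))].

Definition max_singular_value (R : realType) (n : nat) (A : 'M[R]_n) : R :=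
  \big[Num.max/0]_(x <- singular_values A) x.

(* The default value is irrelevant for n >= 1, when there is a singular value
   and all of them are at most the largest one. *)
Definition min_singular_value (R : realType) (n : nat) (A : 'M[R]_n) : R :=
  \big[Num.min/max_singular_value A]_(x <- singular_values A) x.

Definition cond2 (R : realType) (n : nat) (A : 'M[R]_n) : R :=
  max_singular_value A / min_singular_value A.

(* [c; 0], a vector of size k padded by zeros to size m (for k <= m). *)
Definition pad0 (R : realType) (k m : nat) (c : 'cV[R]_k) : 'cV[R]_m :=
  \col_(i < m) oapp (fun j : 'I_k => c j 0) 0 (insub (i : nat)).

Section Evaluation.
Variables (R : realType) (s m : nat) (P : 'I_m -> 'rV[R]_s).

Definition eval_pts (g : {mpoly R[s]}) : 'cV[R]_m :=
  \col_(j < m) g.@[fun i => P j 0 i].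

Definition eval_mx (k : nat) (ts : k.-tuple 'X_{1..s}) : 'M[R]_(m, k) :=
  \matrix_(j < m, i < k) eval_pts 'X_[tnth ts i] j 0.

End Evaluation.

Section ABM.
Variables (R : realType) (s m : nat) (sigma : rel 'X_{1..s}).
Variables (P : 'I_m -> 'rV[R]_s) (eps : R).

Record abm_state := ABMState {
  abm_L : {fset 'X_{1..s}};
  abm_N : {fset 'X_{1..s}};
  abm_GB : {fset {mpoly R[s]}}
}.

Definition abm_init : abm_state := ABMState [fset 0%MM] fset0 fset0.

Definition abm_select (L : {fset 'X_{1..s}}) (t : 'X_{1..s}) : Prop :=
  t \in L /\ forall u, u \in L -> sigma t u.

Definition multiple_of_lead (GB : {fset {mpoly R[s]}}) (u : 'X_{1..s}) : bool :=
  has (fun g : {mpoly R[s]} =>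
         has (fun v => is_leading_term sigma g v && (v <= u)%MM) (msupp g)) GB.

Definition abm_new_terms (GB : {fset {mpoly R[s]}}) (t : 'X_{1..s}) :
    {fset 'X_{1..s}} :=
  [fset u in [seq (U_(i) + t)%MM | i : 'I_s] | ~~ multiple_of_lead GB u].

Definition abm_residual (t : 'X_{1..s}) (k : nat) (ts : k.-tuple 'X_{1..s})
    (c : 'cV[R]_k) : 'cV[R]_m :=
  eval_pts P 'X_[t] - eval_mx P ts *m c.

Definition abm_poly (t : 'X_{1..s}) (k : nat) (ts : k.-tuple 'X_{1..s})
    (c : 'cV[R]_k) : {mpoly R[s]} :=
  'X_[t] - \sum_(i < k) c i 0 *: 'X_[tnth ts i].

Inductive abm_step : abm_state -> abm_state -> Prop :=
| abm_step_N L N GB t k (ts : k.-tuple 'X_{1..s}) (c : 'cV[R]_k) :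
    abm_select L t ->
    increasing_enum sigma N ts ->
    is_lsq_solution (eval_mx P ts) (eval_pts P 'X_[t]) c ->
    eps * norm2 (eval_pts P 'X_[t]) < norm2 (abm_residual t ts c) ->
    abm_step (ABMState L N GB)
             (ABMState ((L `\ t) `|` abm_new_terms GB t) (t |` N) GB)
| abm_step_GB L N GB t k (ts : k.-tuple 'X_{1..s}) (c : 'cV[R]_k) :
    abm_select L t ->
    increasing_enum sigma N ts ->
    is_lsq_solution (eval_mx P ts) (eval_pts P 'X_[t]) c ->
    norm2 (abm_residual t ts c) <= eps * norm2 (eval_pts P 'X_[t]) ->
    abm_step (ABMState L N GB)
             (ABMState [fset u in L | ~~ (t <= u)%MM] N
                       (abm_poly t ts c |` GB)).

Inductive abm_reachable : abm_state -> Prop :=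
| abm_reachable_init : abm_reachable abm_init
| abm_reachable_step S S' :
    abm_reachable S -> abm_step S S' -> abm_reachable S'.

Definition abm_output (N : {fset 'X_{1..s}}) (GB : {fset {mpoly R[s]}}) : Prop :=
  abm_reachable (ABMState fset0 N GB).

End ABM.

(* Main.v *)
Require Import Defs.
From HB Require Import structures.
From mathcomp Require Import all_boot all_order all_algebra.
From mathcomp Require Import finmap mpoly polyrcf classical_sets reals.
From mathcomp Require Import lra.

Set Implicit Arguments.
Unset Strict Implicit.
Unset Printing Implicit Defensive.

Import Order.TTheory GRing.Theory Num.Theory.

Local Open Scope fset_scope.
Local Open Scope ring_scope.

(** Write M for the evaluation matrix of the terms of N and b = t(P). A term
enters N only when its evaluation vector has a residual of positive norm
against the previous ones, so M is invertible. Since M c_E = b and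
M [c; 0] = b - g(P), we get M (Delta c) = g(P), hence
sigma_min |Delta c| <= |g(P)| and |b| <= sigma_max |c_E|; the first bound is
the quotient of these. Every term of N precedes every term waiting in L, so the
leading term of g is the term at which the algorithm produced it, and the
second bound is the acceptance test passed at that step.

That sigma_min and sigma_max, defined through the roots of the characteristic
polynomial of M^T M, bound |M x| / |x| is shown without diagonalization: for a
symmetric matrix A let a be the largest number with a |x|^2 <= x^T A x for all
x. If A - a were invertible, its quadratic form would be bounded below by a
positive multiple of |x|^2, contradicting the maximality of a; so a is an
eigenvalue. *)

(** * The Euclidean inner product and its norm *)

Section DotProduct.
Variable R : realType.

Definition dot (n : nat) (u v : 'cV[R]_n) : R := (u^T *m v) 0 0.

Lemma dotE n (u v : 'cV[R]_n) : dot u v = \sum_i u i 0 * v i 0.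
Proof. by rewrite /dot mxE; apply: eq_bigr => i _; rewrite mxE. Qed.

Lemma dotC n (u v : 'cV[R]_n) : dot u v = dot v u.
Proof. by rewrite !dotE; apply: eq_bigr => i _; rewrite mulrC. Qed.

Lemma dotBl n (u v w : 'cV[R]_n) : dot (u - v) w = dot u w - dot v w.
Proof. by rewrite /dot linearB mulmxBl !mxE. Qed.

Lemma dotBr n (u v w : 'cV[R]_n) : dot w (u - v) = dot w u - dot w v.
Proof. by rewrite ![dot w _]dotC dotBl. Qed.

Lemma dotZl n a (u v : 'cV[R]_n) : dot (a *: u) v = a * dot u v.
Proof. by rewrite /dot linearZ -scalemxAl mxE. Qed.

Lemma dotZr n a (u v : 'cV[R]_n) : dot u (a *: v) = a * dot u v.
Proof. by rewrite dotC dotZl dotC. Qed.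

Lemma dot_mulmx m n (A : 'M[R]_(m, n)) u v :
  dot u (A *m v) = dot (A^T *m u) v.
Proof. by rewrite /dot trmx_mul trmxK mulmxA. Qed.

Lemma dot_ge0 n (u : 'cV[R]_n) : 0 <= dot u u.
Proof. by rewrite dotE sumr_ge0 // => i _; rewrite -expr2 sqr_ge0. Qed.

Lemma dot_eq0 n (u : 'cV[R]_n) : (dot u u == 0) = (u == 0).
Proof.
apply/eqP/eqP => [u0|->]; last by rewrite /dot mulmx0 mxE.
apply/colP => i; rewrite mxE; apply/eqP.
move: u0; rewrite dotE => /eqP.
rewrite psumr_eq0 => [/allP/(_ i)|j _]; last by rewrite -expr2 sqr_ge0.
by rewrite mem_index_enum -expr2 sqrf_eq0 => /(_ isT).
Qed.

Lemma dot_gt0 n (u : 'cV[R]_n) : (0 < dot u u) = (u != 0).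
Proof. by rewrite lt0r dot_ge0 dot_eq0 andbT. Qed.

Lemma norm2E n (u : 'cV[R]_n) : norm2 u = Num.sqrt (dot u u).
Proof. by rewrite dotE. Qed.

Lemma norm2_ge0 n (u : 'cV[R]_n) : 0 <= norm2 u.
Proof. exact: sqrtr_ge0. Qed.

Lemma norm2_gt0 n (u : 'cV[R]_n) : (0 < norm2 u) = (u != 0).
Proof. by rewrite norm2E sqrtr_gt0 dot_gt0. Qed.

(** Each product [x i 0 * x j 0] is at most [dot x x] in absolute value, so the sum of the absolute
    values of the entries is a bound; adding 1 makes it positive. *)
Lemma quadratic_form_bounded n (A : 'M[R]_n) :
  exists2 C, 0 < C & forall x, dot x (A *m x) <= C * dot x x.
Proof.
exists (1 + \sum_i \sum_j `|A i j|).
  by rewrite ltr_pwDl // sumr_ge0 // => i _; rewrite sumr_ge0.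
move=> x.
have le_dot i : x i 0 ^+ 2 <= dot x x.
  rewrite dotE (bigD1 i) //= -expr2 lerDl sumr_ge0 // => j _.
  by rewrite -expr2 sqr_ge0.
rewrite mulrDl mul1r -[leLHS]add0r lerD ?dot_ge0 // dotE mulr_suml.
apply: ler_sum => i _; rewrite mxE mulr_sumr mulr_suml.
apply: ler_sum => j _; rewrite mulrCA.
apply: (le_trans (ler_norm _)); rewrite normrM ler_wpM2l // ler_norml.
by have := le_dot i; have := le_dot j; nra.
Qed.

End DotProduct.

(** * Extreme eigenvalues of a symmetric matrix *)

Section Rayleigh.
Variables (R : realType) (n : nat).
Implicit Types A B : 'M[R]_n.

(* With C bounding x^T B^-1 x / x^T x, positivity at x - B^-1 x / C reads
   0 <= x^T B x - 2 x^T x / C + x^T B^-1 x / C^2. *)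
Lemma psd_unit_coercive B :
    B^T = B -> B \in unitmx -> (forall x, 0 <= dot x (B *m x)) ->
  exists2 d, 0 < d & forall x, d * dot x x <= dot x (B *m x).
Proof.
move=> symB uB Bge0; have [C C0 invB_le] := quadratic_form_bounded (invmx B).
exists C^-1; first by rewrite invr_gt0.
move=> x; have := Bge0 (x - C^-1 *: (invmx B *m x)).
rewrite mulmxBr -scalemxAr mulKVmx // dotBl !dotBr !dotZl !dotZr.
rewrite (dot_mulmx B (invmx B *m x)) symB mulKVmx // [dot (invmx B *m x) x]dotC.
have : C^-1 * dot x (invmx B *m x) <= dot x x.
  by rewrite mulrC ler_pdivrMr // mulrC.
rewrite -(ler_pM2l (_ : 0 < C^-1)) ?invr_gt0 // => h1 h2; lra.
Qed.

Lemma symmetric_min_eigenvalue A : (0 < n)%N -> A^T = A ->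
  exists2 a, eigenvalue A a & forall x, a * dot x x <= dot x (A *m x).
Proof.
move=> n_gt0 symA.
pose E : set R := [set a | forall x, a * dot x x <= dot x (A *m x)]%classic.
have E_ub x : x != 0 -> ubound E (dot x (A *m x) / dot x x).
  by move=> x0 a Ea; rewrite ler_pdivlMr ?dot_gt0.
have E_nonempty : (E !=set0)%classic.
  have [C _ CP] := quadratic_form_bounded (- A).
  exists (- C) => x; have := CP x.
  by rewrite mulNmx -[- (A *m x)]sub0r dotBr {1}/dot mulmx0 mxE; lra.
have [e e0] : exists e : 'cV[R]_n, e != 0.
  exists (const_mx 1); apply/negP => /eqP/colP/(_ (Ordinal n_gt0))/eqP.
  by rewrite !mxE oner_eq0.
(* The Rayleigh quotient of each nonzero [x] is an upper bound of [E], so the supremum satisfies the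
   inequality at every [x]. *)
have E_sup : E (sup E).
  move=> x; have [->|x0] := eqVneq x 0.
    by rewrite /dot !mulmx0 !mxE mulr0.
  by rewrite -ler_pdivlMr ?dot_gt0 //; apply: ge_sup => //; apply: E_ub.
exists (sup E) => //.
apply: contraT => not_eig.
pose B := A - (sup E)%:M.
have Bx x : dot x (B *m x) = dot x (A *m x) - sup E * dot x x.
  by rewrite mulmxBl mul_scalar_mx dotBr dotZr.
have uB : B \in unitmx.
  by rewrite -row_free_unit -kermx_eq0; move: not_eig; rewrite negbK.
have [||d d0 dP] := psd_unit_coercive _ uB.
- by rewrite linearB /= symA tr_scalar_mx.
- by move=> x; rewrite Bx subr_ge0.
have /(ub_le_sup (ex_intro _ _ (E_ub e e0))) : E (sup E + d).
  by move=> x; have := dP x; rewrite Bx mulrDl; lra.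
by rewrite gerDl leNgt d0.
Qed.

Lemma symmetric_max_eigenvalue A : (0 < n)%N -> A^T = A ->
  exists2 a, eigenvalue A a & forall x, dot x (A *m x) <= a * dot x x.
Proof.
move=> n_gt0 symA.
(* The largest eigenvalue of [A] is minus the smallest one of [- A]. *)
have [|a /eigenvalueP[v vA v0] aP] := @symmetric_min_eigenvalue (- A) n_gt0.
  by rewrite linearN /= symA.
exists (- a).
  apply/eigenvalueP; exists v => //.
  by rewrite scaleNr -vA mulmxN opprK.
move=> x; have := aP x; rewrite mulNmx -[- (A *m x)]sub0r dotBr.
by rewrite {2}/dot mulmx0 mxE; lra.
Qed.

End Rayleigh.

(** * Singular values as bounds on the stretching of vectors *)

Section SingularValues.
Variables (R : realType) (n : nat) (M : 'M[R]_n).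

Let dotMM x : dot x (M^T *m M *m x) = dot (M *m x) (M *m x).
Proof. by rewrite -mulmxA dot_mulmx trmxK. Qed.

Let symMM : (M^T *m M)^T = M^T *m M.
Proof. by rewrite trmx_mul trmxK. Qed.

Let mem_eigenvalues a :
  (a \in rootsR (char_poly (M^T *m M))) = eigenvalue (M^T *m M) a.
Proof.
rewrite eigenvalue_root_char -roots_on_rootsR ?inE //.
exact/monic_neq0/char_poly_monic.
Qed.

Lemma norm2_mulmx_le x : norm2 (M *m x) <= max_singular_value M * norm2 x.
Proof.
have [n0|n_gt0] := posnP n.
  have -> : M *m x = 0 by apply/colP => -[i ltin]; exfalso; rewrite n0 in ltin.
  have -> : x = 0 by apply/colP => -[i ltin]; exfalso; rewrite n0 in ltin.
  by rewrite norm2E /dot mulmx0 mxE sqrtr0 mulr0.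
have [a eig_a aP] := symmetric_max_eigenvalue n_gt0 symMM.
have le_max : Num.sqrt a <= max_singular_value M.
  apply: (@le_bigmax_seq _ _ _ _ 0 (Num.sqrt a) xpredT id) => //.
  by apply: map_f; rewrite mem_eigenvalues.
apply: (le_trans _ (ler_wpM2r (norm2_ge0 x) le_max)).
have [a0|a0] := leP 0 a; first by rewrite !norm2E -sqrtrM // ler_wsqrtr -?dotMM.
(* A negative [a] forces [M *m x] to have norm 0. *)
have : dot (M *m x) (M *m x) <= 0.
  by rewrite -dotMM (le_trans (aP x)) // mulr_le0_ge0 ?dot_ge0 // ltW.
by move=> /ler0_sqrtr; rewrite norm2E => ->; rewrite mulr_ge0 ?sqrtr_ge0.
Qed.

Lemma norm2_mulmx_ge x : min_singular_value M * norm2 x <= norm2 (M *m x).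
Proof.
have [n0|n_gt0] := posnP n.
  have -> : x = 0 by apply/colP => -[i ltin]; exfalso; rewrite n0 in ltin.
  by rewrite [norm2 0]norm2E /dot mulmx0 mxE sqrtr0 mulr0 norm2_ge0.
have [a eig_a aP] := symmetric_min_eigenvalue n_gt0 symMM.
have min_le : min_singular_value M <= Num.sqrt a.
  apply: (@ge_bigmin_seq _ _ _ _ _ (Num.sqrt a) xpredT id) => //.
  by apply: map_f; rewrite mem_eigenvalues.
apply: (le_trans (ler_wpM2r (norm2_ge0 x) min_le)).
have [a0|a0] := leP 0 a; first by rewrite !norm2E -sqrtrM // ler_wsqrtr -?dotMM.
(* The square root of a negative number is 0 by convention, so the bound is trivial here. *)
by rewrite (ler0_sqrtr (ltW a0)) mul0r norm2_ge0.
Qed.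

(** For an eigenvector [w] of [M^T *m M] with eigenvalue [a], the product of [a] and [dot w w] is
    the squared norm of [M *m w], nonzero since [M] is invertible. *)
Lemma singular_values_gt0 x : M \in unitmx -> x \in singular_values M -> 0 < x.
Proof.
move=> uM /mapP[a]; rewrite mem_eigenvalues => /eigenvalueP[v vMM v0] ->.
rewrite sqrtr_gt0.
have w0 : v^T != 0 by rewrite trmx_eq0.
(* Eigenvectors are rows here; symmetry turns [v] into a column eigenvector. *)
have : M^T *m M *m v^T = a *: v^T.
  by rewrite -symMM -trmx_mul vMM linearZ.
move=> /(congr1 (dot v^T)); rewrite dotMM dotZr => eq_a.
have : 0 < a * dot v^T v^T.
  rewrite -eq_a dot_gt0; apply: contraNneq w0 => Mw0.
  by rewrite -(mulKmx uM v^T) Mw0 mulmx0.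
by rewrite pmulr_lgt0 ?dot_gt0.
Qed.

Lemma min_singular_value_gt0 :
  (0 < n)%N -> M \in unitmx -> 0 < min_singular_value M.
Proof.
move=> n_gt0 uM.
have [a eig_a _] := symmetric_max_eigenvalue n_gt0 symMM.
have sv_a : Num.sqrt a \in singular_values M.
  by apply: map_f; rewrite mem_eigenvalues.
(* The default of the minimum is the largest singular value, positive because it dominates the
   singular value [Num.sqrt a]. *)
rewrite /min_singular_value big_seq_cond; apply: lt_bigmin => [|x].
  apply: lt_le_trans (singular_values_gt0 uM sv_a) _.
  exact: (@le_bigmax_seq _ _ _ _ 0 (Num.sqrt a) xpredT id).
by rewrite andbT; apply: singular_values_gt0.
Qed.

Lemma max_singular_value_ge0 : 0 <= max_singular_value M.
Proof. exact: bigmax_ge_id. Qed.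

(** The smallest singular value bounds [norm2 y] above and the largest bounds [norm2 x] below. It
    serves with [x] the exact solution and [y] its error. *)
Lemma cond2_perturbation (x y : 'cV[R]_n) :
    (0 < n)%N -> M \in unitmx -> M *m x != 0 ->
  norm2 y / norm2 x <= norm2 (M *m y) / norm2 (M *m x) * cond2 M.
Proof.
move=> n_gt0 uM Mx0.
have smin := min_singular_value_gt0 n_gt0 uM.
have x0 : x != 0 by apply: contraNneq Mx0 => ->; rewrite mulmx0.
rewrite /cond2.
have -> : norm2 (M *m y) / norm2 (M *m x) *
    (max_singular_value M / min_singular_value M) =
    (norm2 (M *m y) / min_singular_value M) *
    (max_singular_value M / norm2 (M *m x)).
  by rewrite mulrACA [RHS]mulrACA [X in _ * X = _]mulrC.
apply: ler_pM; rewrite ?invr_ge0 ?norm2_ge0 //.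
  by rewrite ler_pdivlMr // mulrC norm2_mulmx_ge.
rewrite ler_pdivlMr ?norm2_gt0 // mulrC ler_pdivrMr ?norm2_gt0 //.
exact: norm2_mulmx_le.
Qed.
End SingularValues.

(** * Term orderings and leading terms *)

Section TermOrdering.
Variables (s : nat) (sigma : rel 'X_{1..s}).
Hypothesis sigma_to : term_ordering sigma.

Lemma term_lt_irreflexive : irreflexive (term_lt sigma).
Proof. by move=> t; rewrite /term_lt eqxx. Qed.

Lemma term_lt_le_trans t u v :
  term_lt sigma t u -> sigma u v -> term_lt sigma t v.
Proof.
case/andP=> neq_tu le_tu le_uv; apply/andP; split.
  apply: contraNneq neq_tu => eq_tv; apply/eqP/(term_ordering_anti sigma_to).
  by rewrite le_tu eq_tv.
exact: (term_ordering_trans sigma_to) le_uv.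
Qed.

Lemma term_lt_transitive : transitive (term_lt sigma).
Proof. by move=> u t v lt_tu /andP[_]; apply: term_lt_le_trans. Qed.

Lemma term_lt_mulU i t : term_lt sigma t (U_(i) + t)%MM.
Proof.
apply/andP; split; last first.
  rewrite -{1}[t]add0m; apply: (term_ordering_mul sigma_to).
  exact: (term_ordering_ge1 sigma_to).
by rewrite -{1}[t]add0m eqm_add2r eq_sym mnm1_eq0.
Qed.

Lemma leading_term_unique (R : realType) (g : {mpoly R[s]}) t u :
  is_leading_term sigma g t -> is_leading_term sigma g u -> t = u.
Proof.
move=> /andP[tg /allP g_le_t] /andP[ug /allP g_le_u].
by apply: (term_ordering_anti sigma_to); rewrite g_le_u // g_le_t.
Qed.

Lemma increasing_enum_sum (V : nmodType) (N : {fset 'X_{1..s}}) k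
    (ts : k.-tuple 'X_{1..s}) (F : 'X_{1..s} -> V) :
  increasing_enum sigma N ts -> \sum_(u <- N) F u = \sum_(i < k) F (tnth ts i).
Proof.
case=> ts_sorted N_ts; rewrite -(big_tuple _ _ ts predT F).
apply/perm_big/uniq_perm => //.
exact: sorted_uniq term_lt_transitive term_lt_irreflexive _ ts_sorted.
Qed.

(** The subtracted terms all precede [t], so the coefficient of [t] stays 1 and no term beyond [t]
    appears. *)
Lemma leading_term_abm_poly (R : realType) t k (ts : k.-tuple 'X_{1..s})
    (c : 'cV[R]_k) :
    (forall u, u \in ts -> term_lt sigma u t) ->
  is_leading_term sigma (abm_poly t ts c) t.
Proof.
move=> ts_lt; apply/andP; split.
  rewrite mcoeff_msupp mcoeffB mcoeffX eqxx raddf_sum big1 ?subr0 ?oner_eq0 //=.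
  move=> i _; rewrite mcoeffZ mcoeffX.
  by case/andP: (ts_lt _ (mem_tnth i ts)) => /negPf -> _; rewrite mulr0.
apply/allP => u; rewrite mcoeff_msupp; apply: contraR => not_le_ut.
have neq_tu : (t == u) = false.
  by apply: contraNF not_le_ut => /eqP <-; apply: term_ordering_refl.
rewrite mcoeffB mcoeffX neq_tu raddf_sum big1 ?subr0 //= => i _.
rewrite mcoeffZ mcoeffX; have [eq_iu|_] := eqVneq; last by rewrite mulr0.
by case/andP: (ts_lt _ (mem_tnth i ts)) => _; rewrite eq_iu (negPf not_le_ut).
Qed.

End TermOrdering.

(** * Evaluation at the points *)

Section EvalPts.
Variables (R : realType) (s m : nat) (P : 'I_m -> 'rV[R]_s).

Lemma eval_ptsB g h : eval_pts P (g - h) = eval_pts P g - eval_pts P h.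
Proof. by apply/colP => j; rewrite !mxE mevalB. Qed.

Lemma eval_pts_lincomb k (c : 'cV[R]_k) (F : 'I_k -> {mpoly R[s]}) :
  eval_pts P (\sum_(i < k) c i 0 *: F i) =
  \sum_(i < k) c i 0 *: eval_pts P (F i).
Proof.
apply/colP => j; rewrite mxE summxE raddf_sum.
by apply: eq_bigr => i _; rewrite /= mevalZ !mxE.
Qed.

Lemma eval_mx_mul k (ts : k.-tuple 'X_{1..s}) (c : 'cV[R]_k) :
  eval_mx P ts *m c = \sum_(i < k) c i 0 *: eval_pts P 'X_[tnth ts i].
Proof.
apply/colP => j; rewrite mxE summxE; apply: eq_bigr => i _.
by rewrite !mxE mulrC.
Qed.

Lemma eval_pts_abm_poly t k (ts : k.-tuple 'X_{1..s}) (c : 'cV[R]_k) :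
  eval_pts P (abm_poly t ts c) = abm_residual P t ts c.
Proof. by rewrite eval_ptsB eval_pts_lincomb -eval_mx_mul. Qed.

Lemma eval_mx_mul_pad0 k (ts : m.-tuple 'X_{1..s}) (le_km : (k <= m)%N)
    (c : 'cV[R]_k) :
  eval_mx P ts *m pad0 m c =
  \sum_(i < k) c i 0 *: eval_pts P 'X_[tnth ts (widen_ord le_km i)].
Proof.
rewrite eval_mx_mul (bigID (fun i : 'I_m => (i < k)%N)) /= big_ord_narrow.
rewrite [X in _ + X]big1 ?addr0 => [|i ge_ik].
  by apply: eq_bigr => i _; rewrite mxE /= valK.
by rewrite mxE insubN // scale0r.
Qed.

End EvalPts.

(** * Invariants of the algorithm *)

Section ABMInvariants.
Variables (R : realType) (s m : nat) (sigma : rel 'X_{1..s}).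
Variables (P : 'I_m -> 'rV[R]_s) (eps : R).
Hypotheses (sigma_to : term_ordering sigma) (eps_gt0 : 0 < eps).
Local Notation reachable := (abm_reachable sigma P eps).

(** The selected term is the minimum of [L], and the terms added after it are proper multiples of
    it, hence larger. *)
Lemma abm_N_lt_L S : reachable S ->
  forall u v, u \in abm_N S -> v \in abm_L S -> term_lt sigma u v.
Proof.
elim=> {S} // S S' _ IH stepS; move: IH; case: S S' / stepS => /=.
  move=> L N GB t k ts c [tL t_min] _ _ _ IH u v.
  have t_lt w : w \in L -> w != t -> term_lt sigma t w.
    by move=> wL neq_wt; rewrite /term_lt eq_sym neq_wt t_min.
  have t_ltU w : w \in abm_new_terms sigma GB t -> term_lt sigma t w.
    by rewrite !inE => /andP[/mapP[i _ ->] _]; apply: term_lt_mulU.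
  rewrite in_fset1U in_fsetU in_fsetD1 => /predU1P[->|uN].
    by case/orP => [/andP[neq_vt vL]|/t_ltU //]; apply: t_lt.
  case/orP => [/andP[_ vL]|/t_ltU lt_tv]; first exact: IH.
  exact: term_lt_transitive (IH u t uN tL) lt_tv.
move=> L N GB t k ts c _ _ _ _ IH u v uN; rewrite !inE => /andP[vL _].
exact: IH.
Qed.

Lemma abm_N_free S : reachable S ->
  forall f : 'X_{1..s} -> R, \sum_(u <- abm_N S) f u *: eval_pts P 'X_[u] = 0 ->
  forall u, u \in abm_N S -> f u = 0.
Proof.
elim=> {S} // S S' reachS IH stepS; move: reachS IH.
case: S S' / stepS => // L N GB t k ts c [tL _] enumN lsq_c big_res reachS IH f.
have tN : t \notin N.
  apply/negP => tN; have := abm_N_lt_L reachS tN tL.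
  by rewrite term_lt_irreflexive.
rewrite /= big_fsetU1 //= => sum0.
have ft0 : f t = 0.
  apply/eqP/negPn/negP => ft0.
  (* These coefficients come from solving the relation for the evaluation vector of [t]. *)
  have := lsq_c (\col_i (- (f t)^-1 * f (tnth ts i))).
  rewrite leNgt => /negP[].
  have -> : eval_pts P 'X_[t] -
      eval_mx P ts *m \col_i (- (f t)^-1 * f (tnth ts i)) = 0.
    apply: (scalerI ft0); rewrite scaler0 -sum0 scalerBr; congr (_ + _).
    rewrite (increasing_enum_sum sigma_to _ enumN) eval_mx_mul scaler_sumr -sumrN.
    apply: eq_bigr => i _; rewrite mxE scalerA mulrA mulrN divff // mulN1r.
    by rewrite scaleNr opprK.
  rewrite [norm2 0]norm2E /dot mulmx0 mxE sqrtr0.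
  by apply: le_lt_trans big_res; rewrite mulr_ge0 ?norm2_ge0 // ltW.
move: sum0; rewrite ft0 scale0r add0r => /IH fN u.
by rewrite in_fset1U => /predU1P[->|/fN].
Qed.

Lemma abm_GB_small S : reachable S -> forall g, g \in abm_GB S ->
  exists2 t, is_leading_term sigma g t &
    norm2 (eval_pts P g) <= eps * norm2 (eval_pts P 'X_[t]).
Proof.
elim=> {S} // S S' reachS IH stepS; move: reachS IH.
case: S S' / stepS => // L N GB t k ts c [tL _] [_ N_ts] _ small reachS IH g.
rewrite in_fset1U => /predU1P[->|/IH //]; exists t.
  apply: leading_term_abm_poly => // u; rewrite -N_ts => uN.
  exact: (abm_N_lt_L reachS uN tL).
by rewrite eval_pts_abm_poly.
Qed.

Lemma abm_eval_mx_unit N GB (ts : m.-tuple 'X_{1..s}) :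
    abm_output sigma P eps N GB -> increasing_enum sigma N ts ->
  eval_mx P ts \in unitmx.
Proof.
move=> out enumN; rewrite -unitmx_tr -row_free_unit -kermx_eq0.
apply/rowV0P => v /sub_kermxP v_ker.
have ts_uniq : uniq ts.
  case: enumN => + _; apply: sorted_uniq.
    exact: term_lt_transitive.
  exact: term_lt_irreflexive.
have ev0 : eval_mx P ts *m v^T = 0.
  by rewrite -[LHS]trmxK trmx_mul trmxK v_ker trmx0.
(* Turns coordinates indexed by columns into coefficients indexed by terms; the terms being
   distinct, each sum over an entry of [ts] has one summand. *)
pose f u := \sum_(i < m | tnth ts i == u) v 0 i.
have f_ts i : f (tnth ts i) = v 0 i.
  rewrite /f (big_pred1 i) // => j /=.
  by apply/eqP/eqP => [|-> //]; apply/tuple_uniqP.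
apply/rowP => i; rewrite mxE -f_ts.
apply: (abm_N_free out); last by rewrite /= (proj2 enumN) mem_tnth.
rewrite /= (increasing_enum_sum sigma_to _ enumN) -[RHS]ev0 eval_mx_mul.
by apply: eq_bigr => j _; rewrite f_ts mxE.
Qed.

End ABMInvariants.

Theorem mainTheorem2 (R : realType) (s m : nat) (sigma : rel 'X_{1..s})
    (eps : R) (P : 'I_m -> 'rV[R]_s)
    (N : {fset 'X_{1..s}}) (GB : {fset {mpoly R[s]}})
    (ts : m.-tuple 'X_{1..s})
    (g : {mpoly R[s]}) (t : 'X_{1..s}) (k : nat) (le_km : (k <= m)%N)
    (c : 'cV[R]_k) (cE : 'cV[R]_m) :
  term_ordering sigma ->
  0 < eps ->
  (1 <= m)%N ->
  abm_output sigma P eps N GB ->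
  increasing_enum sigma N ts ->
  g \in GB ->
  is_leading_term sigma g t ->
  g = 'X_[t] - \sum_(i < k) c i 0 *: 'X_[tnth ts (widen_ord le_km i)] ->
  eval_pts P 'X_[t] != 0 ->
  eval_mx P ts *m cE = eval_pts P 'X_[t] ->
  norm2 (cE - pad0 m c) / norm2 cE
    <= norm2 (eval_pts P g) / norm2 (eval_pts P 'X_[t])
       * cond2 (eval_mx P ts)
  /\ norm2 (eval_pts P g) / norm2 (eval_pts P 'X_[t])
       * cond2 (eval_mx P ts)
     <= eps * cond2 (eval_mx P ts).
Proof.
move=> sigma_to eps_gt0 m_gt0 out enumN gGB lead_gt def_g t_neq0 def_cE.
have uM := abm_eval_mx_unit sigma_to eps_gt0 out enumN.
split.
  have -> : eval_pts P g = eval_mx P ts *m (cE - pad0 m c).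
    by rewrite mulmxBr def_cE eval_mx_mul_pad0 def_g eval_ptsB eval_pts_lincomb.
  by rewrite -def_cE; apply: cond2_perturbation; rewrite ?def_cE.
have [u lead_gu small_g] := abm_GB_small sigma_to out gGB.
(* The invariant speaks of the term selected when [g] was produced; uniqueness of leading terms
   identifies it with [t]. *)
rewrite -(leading_term_unique sigma_to lead_gt lead_gu) in small_g.
apply: ler_wpM2r; last by rewrite ler_pdivrMr ?norm2_gt0.
rewrite divr_ge0 ?max_singular_value_ge0 // ltW //.
exact: min_singular_value_gt0.
Qed.
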